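(* Let $A$ be a commutative ring and $n\ge 0$ an integer. If $\mathrm{Kdim}\,A<n$ and $b_1,\dots,b_n\in A$, then there exist $x_1,\dots,x_n\in A$ such that for all $a\in A$ $$\mathrm{D}_A(a,b_1,\dots,b_n)=\mathrm{D}_A(b_1+ax_1,\dots,b_n+ax_n).$$ Consequently, in a commutative ring of Krull dimension $\le n$, every finitely generated ideal has the same radical as some ideal generated by at most $n+1$ elements.
   Context: $\mathrm{D}_A(y_1,\dots,y_m)=\sqrt{\langle y_1,\dots,y_m\rangle}$ denotes the radical (nilradical) of the ideal of $A$ generated by $y_1,\dots,y_m$. $\mathrm{Kdim}$ denotes Krull dimension; $\mathrm{Kdim}\,A\le -1$ means that $A$ is the trivial ring. (The paper's constructive definition, classically equivalent to the usual one: for $\ell\ge 0$, $\mathrm{Kdim}\,A\le\ell$ iff the lattice of radicals of finitely generated ideals of $A$ has Krull dimension $\le\ell$; equivalently, for all $x_0,\dots,x_\ell\in A$ there exist $b_0,\dots,b_\ell\in A$ with $\mathrm{D}_A(b_0x_0)=\mathrm{D}_A(0)$, $\mathrm{D}_A(b_ix_i)\subseteq \mathrm{D}_A(b_{i-1},x_{i-1})$ for $1\le i\le\ell$, and $\mathrm{D}_A(b_\ell,x_\ell)=\mathrm{D}_A(1)$.) No noetherian hypothesis is made. *)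

(* Defs.v *)
From mathcomp Require Import all_boot all_algebra.
From mathcomp Require Import classical_sets.

Set Implicit Arguments.
Unset Strict Implicit.
Unset Printing Implicit Defensive.

Import GRing.Theory.
Local Open Scope classical_set_scope.
Local Open Scope ring_scope.

(* Rings are comPzRingType throughout, so that the zero ring is allowed. *)

Definition ideal_gen (A : comPzRingType) (s : seq A) : set A :=
  [set z | exists c : 'I_(size s) -> A, z = \sum_(i < size s) c i * s`_i].

Definition radical (A : comPzRingType) (I : set A) : set A :=
  [set z | exists k : nat, I (z ^+ k)].

Definition D (A : comPzRingType) (s : seq A) : set A := radical (ideal_gen s).

(* Kdim A <= l for l >= 0, in the constructive form (every sequence
   x_0, ..., x_l has a complementary sequence b_0, ..., b_l), which is
   classically equivalent to the bound on the lengths of chains of primes. *)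
Definition Kdim_le (A : comPzRingType) (l : nat) : Prop :=
  forall x : l.+1.-tuple A, exists b : l.+1.-tuple A,
    [/\ D [:: b`_0 * x`_0] = D [:: 0],
        forall i : nat, (1 <= i <= l)%N ->
          D [:: b`_i * x`_i] `<=` D [:: b`_i.-1; x`_i.-1]
      & D [:: b`_l; x`_l] = D [:: 1]].

(* Kdim A < n means Kdim A <= n - 1, and Kdim A <= -1 means that A is
   the zero ring. *)
Definition Kdim_lt (A : comPzRingType) (n : nat) : Prop :=
  if n is l.+1 then Kdim_le A l else 1 = 0 :> A.

(* Main.v *)
Require Import Defs.
From mathcomp Require Import all_boot all_algebra.
From mathcomp Require Import classical_sets.

Set Implicit Arguments.
Unset Strict Implicit.
Unset Printing Implicit Defensive.

Import GRing.Theory.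
Local Open Scope classical_set_scope.
Local Open Scope ring_scope.

(** The witness [x] for a sequence [b_1, ..., b_n] is a complementary sequence
    of [b] as provided by the Krull dimension bound; since it is chosen before
    [a], it serves all [a] at once.  Put [J = D(b_1 + a x_1, ..., b_n + a x_n)].
    The one algebraic fact needed is that in a radical ideal, [u + v] and [u v]
    together yield both [u] and [v] ([radical_ideal_sum_prod]): a sum of two
    elements that are orthogonal modulo [J] generates the same radical as its
    two summands.  As [x_1 b_1] is nilpotent, [b_1] and [a x_1] are in [J]; the
    next inclusion [D(x_2 b_2) <= D(x_1, b_1)], multiplied by [a], then puts
    [a x_2 b_2] in [J], so [b_2] and [a x_2] are in [J], and so on
    ([complementary_mem]).  At the end [1] is in [D(x_n, b_n)], which multiplied
    by [a] gives that [a] is in [J].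

    The bound on the number of generators follows by adding generators one at
    a time: a new generator [a] is absorbed in the [n + 1] present ones, each
    modified by a multiple of [a]. *)

Section RadicalIdeals.

Variable A : comPzRingType.
Implicit Types (J : set A) (s t : seq A) (a u v x y z : A).

Record radical_ideal J : Prop := RadicalIdeal {
  radical_ideal0 : J 0;
  radical_idealD : forall x y, J x -> J y -> J (x + y);
  radical_idealM : forall x y, J y -> J (x * y);
  radical_idealX : forall x k, J (x ^+ k) -> J x }.

Lemma ideal_gen0 s : ideal_gen s 0.
Proof. by exists (fun=> 0); rewrite big1 // => i _; rewrite mul0r. Qed.

Lemma ideal_genD s x y : ideal_gen s x -> ideal_gen s y -> ideal_gen s (x + y).
Proof.
move=> [c ->] [d ->]; exists (fun i => c i + d i).
by rewrite -big_split; apply: eq_bigr => i _; rewrite mulrDl.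
Qed.

Lemma ideal_genM s x y : ideal_gen s y -> ideal_gen s (x * y).
Proof.
move=> [c ->]; exists (fun i => x * c i).
by rewrite mulr_sumr; apply: eq_bigr => i _; rewrite mulrA.
Qed.

Lemma radical_ideal_D s : radical_ideal (D s).
Proof.
split=> [|x y [k xk] [l yl]|x y [k yk]|x k [l xkl]].
- by exists 1%N; rewrite expr1; apply: ideal_gen0.
- exists (k + l)%N; rewrite exprDn.
  (* In each binomial term, x has exponent at least k or y at least l. *)
  apply: big_ind => [|u v|i _]; [exact: ideal_gen0 | exact: ideal_genD |].
  rewrite -mulr_natl; apply: ideal_genM.
  have [li|/ltnW il] := leqP l i.
    by rewrite -(subnK li) exprD; do 2! apply: ideal_genM.
  have -> : (k + l - i = l - i + k)%N by rewrite -addnBA //; apply: addnC.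
  by rewrite mulrC exprD; do 2! apply: ideal_genM.
- by exists k; rewrite exprMn; apply: ideal_genM.
- by exists (k * l)%N; rewrite exprM.
Qed.

Lemma mem_D s x : x \in s -> D s x.
Proof.
move=> sx; exists 1%N; rewrite expr1.
have ltxs : (index x s < size s)%N by rewrite index_mem.
exists (fun i => (i == Ordinal ltxs)%:R).
rewrite (bigD1 (Ordinal ltxs)) //= eqxx mul1r nth_index // big1 ?addr0 //.
by move=> i /negbTE ->; rewrite mul0r.
Qed.

Lemma D_min s J : radical_ideal J -> (forall x, x \in s -> J x) -> D s `<=` J.
Proof.
move=> [J0 JD JM JX] sJ z [k [c zk]]; apply: (JX _ k); rewrite zk.
apply: big_ind => [|x y|i _] //; first exact: JD.
exact/JM/sJ/mem_nth.
Qed.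

Lemma eq_D s t :
  (forall x, x \in s -> D t x) -> (forall x, x \in t -> D s x) -> D s = D t.
Proof.
by move=> st ts; rewrite eqEsubset; split; apply: D_min => //;
  apply: radical_ideal_D.
Qed.

(** The equation [u ^+ 2 = u * (u + v) - u * v] puts [u] in [J]. *)
Lemma radical_ideal_sum_prod J u v :
  radical_ideal J -> J (u + v) -> J (u * v) -> J u /\ J v.
Proof.
move=> [_ JD JM JX].
have summand x y : J (x + y) -> J (x * y) -> J x.
  move=> Jxy Jp; apply: (JX _ 2); rewrite expr2.
  have -> : x * x = x * (x + y) + (-1) * (x * y).
    by rewrite mulrDr mulN1r addrK.
  by apply: JD; apply: JM.
by move=> Juv Jp; split; [|rewrite addrC mulrC in Juv Jp]; apply: summand Jp.
Qed.

(** The elements [z] with [a * z] in [J] form the radical ideal [(J : a)], so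
    it is enough to check the generators of [D s]. *)
Lemma radical_ideal_mulD J a s z :
  radical_ideal J -> (forall x, x \in s -> J (a * x)) -> D s z -> J (a * z).
Proof.
move=> [J0 JD JM JX] sJ; apply: (@D_min s (fun z => J (a * z))) => //.
split=> [|x y Jx Jy|x y Jy|x k Jxk].
- by rewrite mulr0.
- by rewrite mulrDr; apply: JD.
- by rewrite mulrCA; apply: JM.
- apply: (JX _ k.+1).
  have -> : (a * x) ^+ k.+1 = a ^+ k * x * (a * x ^+ k).
    by rewrite exprMn exprSr exprS -!mulrA (mulrCA x).
  exact: JM.
Qed.

(** The inductive core: the previous step puts [a * x i] and [a * b i] in [J],
    which makes [b i.+1] and [a * x i.+1] orthogonal modulo [J], so that their
    sum can be split. *)
Lemma complementary_mem l (b x : nat -> A) a J :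
    radical_ideal J ->
    D [:: x 0 * b 0] = D [:: 0] ->
    (forall i, (1 <= i <= l)%N ->
      D [:: x i * b i] `<=` D [:: x i.-1; b i.-1]) ->
    (forall i, (i <= l)%N -> J (b i + a * x i)) ->
  forall i, (i <= l)%N -> J (b i) /\ J (a * x i).
Proof.
move=> Jrad bx0 bxS Jbx; have [J0 _ JM _] := Jrad.
elim=> [|i IHi] lei; apply: radical_ideal_sum_prod (Jbx _ lei) _ => //;
  rewrite mulrC -mulrA.
  apply: (@radical_ideal_mulD J a [:: 0]) => //.
    by move=> y /[!inE] /eqP ->; rewrite mulr0.
  by rewrite -bx0; apply/mem_D/mem_head.
have [Jb Jx] := IHi (ltnW lei).
apply: (@radical_ideal_mulD J a [:: x i; b i]) => //.
  by move=> y /[!inE] /orP[] /eqP -> //; apply: JM.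
by apply: (bxS i.+1) => //; apply/mem_D/mem_head.
Qed.

(** For [n = l.+1], take for [x] a complementary sequence of [b]. For [n = 0],
    the ring is trivial and both sides are the whole ring. *)
Lemma Kdim_lt_absorb n (b : n.-tuple A) : Kdim_lt A n ->
  exists x : n.-tuple A, forall a,
    D (a :: b) = D [seq tnth b i + a * tnth x i | i <- enum 'I_n].
Proof.
case: n b => [|l] b => [A0|/(_ b) [x [bx0 bxS bxl]]].
  have all0 (y : A) : y = 0 by rewrite -[y]mul1r A0 mul0r.
  exists [tuple] => a; apply: eq_D => y _; rewrite (all0 y);
    exact: radical_ideal0 (radical_ideal_D _).
exists x => a; set t := map _ _; have Jrad := radical_ideal_D t.
have [_ JD JM _] := radical_ideal_D (a :: b).
have Jbx i : (i <= l)%N -> D t (b`_i + a * x`_i).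
  move=> lei; apply: mem_D; apply/mapP; exists (Ordinal (lei : (i < l.+1)%N)).
    exact: mem_enum.
  by rewrite !(tnth_nth 0).
have Jcomp := complementary_mem Jrad bx0 bxS Jbx.
apply: eq_D => y; rewrite ?inE.
  case/orP=> [/eqP ->|/(nthP 0) [i]]; last first.
    by rewrite size_tuple => lti <-; case: (Jcomp i lti).
  rewrite -[a]mulr1; apply: (@radical_ideal_mulD _ a [:: x`_l; b`_l]) => //.
    have [Jb Jx] := Jcomp l (leqnn l).
    by move=> z /[!inE] /orP[] /eqP -> //; apply: radical_idealM.
  by rewrite bxl; apply/mem_D/mem_head.
case/mapP=> i _ ->; apply: JD; last by rewrite mulrC; apply/JM/mem_D/mem_head.
by apply: mem_D; rewrite inE mem_tnth orbT.
Qed.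

Lemma Kdim_lt_generators n s : Kdim_lt A n ->
  exists t : n.-tuple A, D s = D t.
Proof.
move=> dimA; elim: s => [|a s [t st]].
  exists [tuple of nseq n 0]; apply: eq_D => // y.
  rewrite mem_nseq => /andP[_ /eqP ->].
  exact: radical_ideal0 (radical_ideal_D _).
have [x /(_ a) xt] := Kdim_lt_absorb t dimA.
exists [tuple tnth t i + a * tnth x i | i < n]; rewrite /= -xt.
have D_tail (r r' : seq A) : D r = D r' -> forall y, y \in a :: r -> D (a :: r') y.
  move=> rr' y; rewrite inE => /orP[/eqP ->|ry]; first exact/mem_D/mem_head.
  have: D r' y by rewrite -rr'; apply: mem_D.
  apply: D_min => [|z r'z]; first exact: radical_ideal_D.
  by apply: mem_D; rewrite inE r'z orbT.
by apply: eq_D; apply: D_tail.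
Qed.

End RadicalIdeals.

Theorem mainTheorem3 (A : comPzRingType) (n : nat) :
  (Kdim_lt A n ->
     forall b : n.-tuple A, exists x : n.-tuple A, forall a : A,
       D (a :: b) = D [seq tnth b i + a * tnth x i | i <- enum 'I_n])
  /\
  (Kdim_le A n ->
     forall s : seq A, exists t : seq A,
       (size t <= n.+1)%N /\ radical (ideal_gen s) = radical (ideal_gen t)).
Proof.
split=> [dimA b|dimA s]; first exact: Kdim_lt_absorb.
have [t st] := @Kdim_lt_generators A n.+1 s dimA.
by exists t; rewrite size_tuple.
Qed.
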